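(* Let $S$ be a semigroup defined by a semigroup presentation $\mathcal P=\langle A\mid R\rangle$, let $G$ be a subgroup of $S$, and let $X$ be a homotopy base for $\mathcal P$, where $X$ is a set of closed paths. Let $I$, $\mathcal Q=\langle B\mid U\rangle$ (a presentation of the group $G$), $\phi$, $\psi$ and $\Lambda_w$ ($w\in B^+$) be as defined in the context. Then the set of closed paths $K\cup W$ is a homotopy base for the presentation $\langle B\mid U\rangle$ of the group $G$, where $$K=\{\phi(j,\mathbb P):\ \mathbb P\in X,\ j\in I,\ j(\iota\mathbb P)\neq 0\}$$ and $$W=\{\mathbb E_r\,\Lambda_{r_{-1}}\,\phi(\psi(\mathbb E_r))^{-1}\,\Lambda_{r_{+1}}^{-1}:\ r\in U\},\qquad \mathbb E_r=(1,r,+1,1).$$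
   Context: Derivation graphs. $A^*$, $A^+$ are the free monoid and free semigroup on $A$; $1$ denotes the empty word; $u\equiv v$ means equality as words. A semigroup presentation $\langle A\mid R\rangle$ has $R\subseteq A^+\times A^+$, rules $r=(r_{+1},r_{-1})$ (also written $r_{+1}=r_{-1}$), and defines $A^+$ modulo the congruence generated by $R$. Its derivation graph $\Gamma$ has vertex set $A^+$ and edges $\mathbb E=(w_1,r,\epsilon,w_2)$ ($w_1,w_2\in A^*$, $r\in R$, $\epsilon=\pm1$), $\iota\mathbb E\equiv w_1r_\epsilon w_2$, $\tau\mathbb E\equiv w_1r_{-\epsilon}w_2$, $\mathbb E^{-1}=(w_1,r,-\epsilon,w_2)$. Paths (set $P(\Gamma)$) are sequences of composable edges, including empty paths $1_w$; $\iota,\tau,{}^{-1}$ extend to paths; composition is juxtaposition; a path is closed if $\iota\mathbb P\equiv\tau\mathbb P$. For $x,y\in A^*$, $x\cdot(w_1,r,\epsilon,w_2)\cdot y=(xw_1,r,\epsilon,w_2y)$, extended edgewise to paths. Parallel paths ($\parallel$) share initial and terminal vertices. A homotopy relation is an equivalence relation $\sim\ \subseteq\ \parallel$ on $P(\Gamma)$ with: (H1) $(\mathbb E_1\cdot\iota\mathbb E_2)(\tau\mathbb E_1\cdot\mathbb E_2)\sim(\iota\mathbb E_1\cdot\mathbb E_2)(\mathbb E_1\cdot\tau\mathbb E_2)$ for edges; (H2) $\mathbb P\sim\mathbb Q\Rightarrow x\cdot\mathbb P\cdot y\sim x\cdot\mathbb Q\cdot y$; (H3) $\mathbb P\sim\mathbb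 Q\Rightarrow\mathbb R\mathbb P\mathbb S\sim\mathbb R\mathbb Q\mathbb S$ whenever defined; (H4) $\mathbb P\mathbb P^{-1}\sim1_{\iota\mathbb P}$. A set $C$ of closed paths is a homotopy base if the smallest homotopy relation $\sim_C$ containing all pairs $(\mathbb P,1_{\iota\mathbb P})$, $\mathbb P\in C$, equals $\parallel$. Cosets. A subgroup of $S$ is a subsemigroup that is a group. A (right) coset of $G$ is a set $Gs$ ($s\in S$) such that $Gss'=G$ for some $s'\in S$. Let $\{C_i:i\in I\}$ be the (distinct) cosets, with $1\in I$, $C_1=G$, and $0\notin I$. $S$ acts on $I\cup\{0\}$ by $is=j$ if $C_is=C_j$ is a coset, and $is=0$ otherwise ($0s=0$). For $w\in A^+$, $iw$ is the result of acting by the element represented by $w$; $i1=i$ for the empty word. For $i\in I\setminus\{1\}$ fix $r_i,r_i'\in A^+$ representing elements $s_{r_i},s_{r_i'}$ with $Gs_{r_i}=C_i$ and $gs_{r_i}s_{r_i'}=g$ for all $g\in G$; let $r_1,r_1'$ be empty. Fix $e\in A^+$ representing the identity of $G$. The presentation $\mathcal Q$. Let $B=\{[i,a]:i\in I,a\in A,ia\neq0\}$. Define $\phi(i,w)\in B^*$ for $i\in I$, $w\in A^*$, $iw\neq0$ by $\phi(i,1)=1$, $\phi(i,aw)=[i,a]\,\phi(ia,w)$; write $\phi(w)=\phi(1,w)$, where here $1\in I$. Let $U$ consist of the rules $\phi(i,u)=\phi(i,v)$ ($i\in I$, $(u=v)\in R$, $iu\neq0$) and $[i,a]=\phi(er_iar_{ia}')$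 ($i\in I$, $a\in A$, $ia\neq0$). It is known that $\mathcal Q=\langle B\mid U\rangle$ defines $G$ as a semigroup, with $[i,a]$ representing the element of $G$ represented by $er_iar'_{ia}$. The map $\phi$ on paths. For $i\in I$ and an edge $\mathbb E=(w_1,r,\epsilon,w_2)$ of $\Gamma(\mathcal P)$ with $i(\iota\mathbb E)\neq0$, $\phi(i,\mathbb E)=(\phi(i,w_1),\ \phi(iw_1,r_{+1})=\phi(iw_1,r_{-1}),\ \epsilon,\ \phi(iw_1r_{+1},w_2))$, an edge of $\Gamma(\mathcal Q)$; extend edgewise to paths, with $\phi(i,1_w)=1_{\phi(i,w)}$; write $\phi(\mathbb P)=\phi(1,\mathbb P)$. The map $\psi$. $\psi:B^*\to A^*$ is the homomorphism $[i,a]\mapsto er_iar_{ia}'$. For each $u\in U$, with $\mathbb E_u=(1,u,+1,1)$, let $\psi(\mathbb E_u)$ be a fixed (arbitrarily chosen) path in $\Gamma(\mathcal P)$ from $\psi(u_{+1})$ to $\psi(u_{-1})$ (these words represent the same element of $S$). For an edge, $\psi(w_1,u,\epsilon,w_2)=\psi(w_1)\cdot\psi(\mathbb E_u)^{\epsilon}\cdot\psi(w_2)$; extend edgewise to paths, with $\psi(1_w)=1_{\psi(w)}$. The paths $\Lambda_w$ ($w\in B^+$), from $w$ to $\phi(\psi(w))$ in $\Gamma(\mathcal Q)$. For $w\equiv[i,a]$, $\Lambda_w=(1,[i,a]=\phi(er_iar_{ia}'),+1,1)$; for $w\equiv bw'$ with $b=[i,a]\in B$, $w'\in B^+$, $\Lambda_w=(\Lambda_b\cdot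 w')(\phi(er_iar_{ia}')\cdot\Lambda_{w'})$. *)

(* Defs.v *)
From HB Require Import structures.
From mathcomp Require Import all_boot.
From mathcomp Require Import boolp classical_sets.

Set Implicit Arguments.
Unset Strict Implicit.
Unset Printing Implicit Defensive.

Local Open Scope classical_set_scope.

(** Words over [A] are lists; the free semigroup consists of the lists
    different from [[::]].  A rule [r] is the pair [(r_{+1}, r_{-1})]. *)

Section DerivationGraph.
Variable A : Type.

Definition rule : Type := (seq A * seq A)%type.

Definition semigroup_presentation (R : set rule) : Prop :=
  forall r, R r -> r.1 <> [::] /\ r.2 <> [::].

Inductive cong (R : set rule) : seq A -> seq A -> Prop :=
| cong_rule r : R r -> cong R r.1 r.2
| cong_refl u : cong R u u
| cong_sym u v : cong R u v -> cong R v u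
| cong_trans u v w : cong R u v -> cong R v w -> cong R u w
| cong_mul x u v y : cong R u v -> cong R (x ++ u ++ y) (x ++ v ++ y).

(** [pi w] is the element of [S] represented by the nonempty word [w]; the
    value [pi [::]] is irrelevant. *)
Definition semigroup_defined_by (R : set rule) (S : semigroupType)
    (pi : seq A -> S) : Prop :=
  [/\ forall u v, u <> [::] -> v <> [::] -> pi (u ++ v) = (pi u * pi v)%g,
      forall s, exists2 w, w <> [::] & pi w = s
    & forall u v, u <> [::] -> v <> [::] -> (pi u = pi v <-> cong R u v)].

(** The sign of an edge is a boolean, [true] standing for [+1]. *)
Record edge : Type :=
  Edge { e_left : seq A; e_rule : rule; e_sign : bool; e_right : seq A }.

Definition side (r : rule) (eps : bool) : seq A := if eps then r.1 else r.2.

Definition e_iota (E : edge) : seq A :=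
  e_left E ++ side (e_rule E) (e_sign E) ++ e_right E.
Definition e_tau (E : edge) : seq A :=
  e_left E ++ side (e_rule E) (~~ e_sign E) ++ e_right E.
Definition e_inv (E : edge) : edge :=
  Edge (e_left E) (e_rule E) (~~ e_sign E) (e_right E).
Definition e_ctx (x : seq A) (E : edge) (y : seq A) : edge :=
  Edge (x ++ e_left E) (e_rule E) (e_sign E) (e_right E ++ y).

(** A path is stored as its initial vertex together with its list of edges,
    so that the empty paths are [DPath w [::]]; composability, and the fact
    that the edges belong to the graph, are expressed by [is_path]. *)
Record dpath : Type := DPath { p_iota : seq A; p_edges : seq edge }.

Definition p_tau (P : dpath) : seq A :=
  last (p_iota P) (map e_tau (p_edges P)).

Fixpoint composable (R : set rule) (w : seq A) (s : seq edge) : Prop :=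
  if s is E :: s' then
    [/\ R (e_rule E), e_iota E = w & composable R (e_tau E) s']
  else True.

Definition is_path (R : set rule) (P : dpath) : Prop :=
  p_iota P <> [::] /\ composable R (p_iota P) (p_edges P).

Definition p_one (w : seq A) : dpath := DPath w [::].
Definition p_edge (E : edge) : dpath := DPath (e_iota E) [:: E].
(** Meaningful only when [p_tau P = p_iota Q]. *)
Definition p_cat (P Q : dpath) : dpath :=
  DPath (p_iota P) (p_edges P ++ p_edges Q).
Definition p_inv (P : dpath) : dpath :=
  DPath (p_tau P) (rev (map e_inv (p_edges P))).
Definition p_ctx (x : seq A) (P : dpath) (y : seq A) : dpath :=
  DPath (x ++ p_iota P ++ y) [seq e_ctx x E y | E <- p_edges P].

Definition closed_path (R : set rule) (P : dpath) : Prop :=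
  is_path R P /\ p_iota P = p_tau P.

Definition parallel (R : set rule) (P Q : dpath) : Prop :=
  [/\ is_path R P, is_path R Q, p_iota P = p_iota Q & p_tau P = p_tau Q].

Record homotopy_relation (R : set rule) (sim : dpath -> dpath -> Prop) : Prop :=
  HomotopyRelation {
    hr_parallel : forall P Q, sim P Q -> parallel R P Q;
    hr_refl : forall P, is_path R P -> sim P P;
    hr_sym : forall P Q, sim P Q -> sim Q P;
    hr_trans : forall P Q T, sim P Q -> sim Q T -> sim P T;
    hr_H1 : forall E1 E2, R (e_rule E1) -> R (e_rule E2) ->
      sim (p_cat (p_ctx [::] (p_edge E1) (e_iota E2))
                 (p_ctx (e_tau E1) (p_edge E2) [::]))
          (p_cat (p_ctx (e_iota E1) (p_edge E2) [::])
                 (p_ctx [::] (p_edge E1) (e_tau E2)));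
    hr_H2 : forall x y P Q, sim P Q -> sim (p_ctx x P y) (p_ctx x Q y);
    hr_H3 : forall T Z P Q, sim P Q -> is_path R T -> is_path R Z ->
      p_tau T = p_iota P -> p_tau P = p_iota Z ->
      sim (p_cat (p_cat T P) Z) (p_cat (p_cat T Q) Z);
    hr_H4 : forall P, is_path R P -> sim (p_cat P (p_inv P)) (p_one (p_iota P))
  }.

(** The smallest homotopy relation containing [(P, 1_(iota P))], [P] in [C]. *)
Definition homotopy_generated (R : set rule) (C : set dpath) (P Q : dpath) :
    Prop :=
  forall sim, homotopy_relation R sim ->
    (forall Z, C Z -> sim Z (p_one (p_iota Z))) -> sim P Q.

Definition homotopy_base (R : set rule) (C : set dpath) : Prop :=
  (forall P, C P -> closed_path R P) /\
  (forall P Q, homotopy_generated R C P Q <-> parallel R P Q).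

End DerivationGraph.

Section Cosets.
Variable S : semigroupType.

Definition is_identity_of (G : set S) (x : S) : Prop :=
  G x /\ forall g, G g -> (x * g)%g = g /\ (g * x)%g = g.

Definition is_subgroup (G : set S) : Prop :=
  (forall g h, G g -> G h -> G (g * h)%g) /\
  exists2 x, is_identity_of G x &
    forall g, G g -> exists2 h, G h & (g * h)%g = x /\ (h * g)%g = x.

Definition rtranslate (D : set S) (s : S) : set S := [set (g * s)%g | g in D].

Definition is_coset (G D : set S) : Prop :=
  exists2 s, D = rtranslate G s & exists s', rtranslate D s' = G.

(** [C] enumerates the cosets of [G] without repetition, [G] at index [i1]. *)
Definition coset_indexing (G : set S) (I : Type) (C : I -> set S) (i1 : I) :
    Prop :=
  [/\ injective C, forall D, is_coset G D <-> (exists i, C i = D) & C i1 = G].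

(** The action of [S] on the indices of cosets with a zero, [None]. *)
Definition act (I : Type) (C : I -> set S) (oi : option I) (s : S) : option I :=
  if oi is Some i then
    if pselect (exists j, C j = rtranslate (C i) s) is left ex_j
    then Some (projT1 (cid ex_j)) else None
  else None.

End Cosets.

Section Construction.
Variables (A : Type) (S : semigroupType) (pi : seq A -> S).
Variables (I : Type) (C : I -> set S).

Definition actw (oi : option I) (w : seq A) : option I :=
  if w is [::] then oi else act C oi (pi w).

(** [r i] and [r' i] are the words r_i and r_i'. *)
Definition coset_representatives (G : set S) (i1 : I) (r r' : I -> seq A) :
    Prop :=
  [/\ r i1 = [::], r' i1 = [::]
    & forall i, i <> i1 ->
      [/\ r i <> [::], r' i <> [::], rtranslate G (pi (r i)) = C i
        & forall g, G g -> (g * pi (r i) * pi (r' i))%g = g]].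

(** The letter [[i,a]] is the pair [(i, a)], subject to [ia <> 0]. *)
Definition letter : Type := {p : I * A | isSome (actw (Some p.1) [:: p.2])}.

(** [phi] is used only when [iw <> 0], and then every [insub] succeeds. *)
Fixpoint phi (oi : option I) (w : seq A) : seq letter :=
  if w is a :: w' then
    if oi is Some i then
      if (insub (i, a) : option letter) is Some b
      then b :: phi (actw (Some i) [:: a]) w' else [::]
    else [::]
  else [::].

Definition phi_edge (oi : option I) (E : edge A) : edge letter :=
  let oj := actw oi (e_left E) in
  Edge (phi oi (e_left E))
       (phi oj (e_rule E).1, phi oj (e_rule E).2)
       (e_sign E)
       (phi (actw oi (e_left E ++ (e_rule E).1)) (e_right E)).

Definition phi_path (oi : option I) (P : dpath A) : dpath letter :=
  DPath (phi oi (p_iota P)) (map (phi_edge oi) (p_edges P)).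

Variables (i1 : I) (r r' : I -> seq A) (e : seq A).

(** The word e r_i a r_{ia}' attached to the letter [[i,a]]. *)
Definition psi_letter (b : letter) : seq A :=
  let: (i, a) := val b in
  e ++ r i ++ [:: a] ++ oapp r' [::] (actw (Some i) [:: a]).

Definition psi (w : seq letter) : seq A := flatten (map psi_letter w).

Definition relsU (R : set (rule A)) : set (rule letter) :=
  [set u | exists i v, [/\ R v, actw (Some i) v.1 <> None
                         & u = (phi (Some i) v.1, phi (Some i) v.2)]] `|`
  [set u | exists b : letter, u = ([:: b], phi (Some i1) (psi_letter b))].

(** [psiE u] is the path chosen as the image of the edge [(1,u,+1,1)]. *)
Definition psi_choice (R : set (rule A)) (psiE : rule letter -> dpath A) :
    Prop :=
  forall u, relsU R u ->
    [/\ is_path R (psiE u), p_iota (psiE u) = psi u.1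
      & p_tau (psiE u) = psi u.2].

Definition psi_edge (psiE : rule letter -> dpath A) (E : edge letter) :
    dpath A :=
  p_ctx (psi (e_left E))
        (if e_sign E then psiE (e_rule E) else p_inv (psiE (e_rule E)))
        (psi (e_right E)).

Definition psi_path (psiE : rule letter -> dpath A) (P : dpath letter) :
    dpath A :=
  DPath (psi (p_iota P))
        (flatten [seq p_edges (psi_edge psiE E) | E <- p_edges P]).

Definition lambda1 (b : letter) : dpath letter :=
  p_edge (Edge [::] ([:: b], phi (Some i1) (psi_letter b)) true [::]).

(** The value at the empty word is irrelevant. *)
Fixpoint lambda (w : seq letter) : dpath letter :=
  match w with
  | [::] => p_one [::]
  | [:: b] => lambda1 b
  | b :: w' => p_cat (p_ctx [::] (lambda1 b) w')
                     (p_ctx (phi (Some i1) (psi_letter b)) (lambda w') [::])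
  end.

Definition baseK (X : set (dpath A)) : set (dpath letter) :=
  [set T | exists P j, [/\ X P, actw (Some j) (p_iota P) <> None
                         & T = phi_path (Some j) P]].

Definition rule_edge (u : rule letter) : edge letter := Edge [::] u true [::].

Definition pathW (psiE : rule letter -> dpath A) (u : rule letter) :
    dpath letter :=
  p_cat (p_cat (p_cat (p_edge (rule_edge u)) (lambda u.2))
               (p_inv (phi_path (Some i1)
                         (psi_path psiE (p_edge (rule_edge u))))))
        (p_inv (lambda u.1)).

Definition baseW (R : set (rule A)) (psiE : rule letter -> dpath A) :
    set (dpath letter) :=
  [set pathW psiE u | u in relsU R].

End Construction.

Arguments psi_choice {A S} pi {I} C i1 r r' e R psiE.
Arguments relsU {A S} pi {I} C i1 r r' e R.
Arguments baseK {A S} pi {I} C X.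
Arguments baseW {A S} pi {I} C i1 r r' e R psiE.

(* Main.v *)
Require Import Defs.
From mathcomp Require Import all_boot.
From mathcomp Require Import boolp classical_sets.

(** Up to homotopy, Lambda is a natural transformation from the identity to the
    composite of psi and phi, and this composite makes all parallel paths
    homotopic; being invertible, Lambda carries the latter property back to the
    paths themselves.

    In detail, let [sim] be a homotopy relation on the derivation graph of
    <B | U> that identifies each path of [K] and [W] with an empty path.

    - Paths of the graph of [R] that are read by phi as [sim]-homotopic paths,
      from every index at which they do not vanish, form a homotopy relation
      ([phi_pullback_homotopy]).  It contains [X] because [sim] contains [K], and
      hence it contains every parallel pair ([phi_parallel_sim]).  Since psi
      sends parallel paths to parallel paths, phi (psi P) and phi (psi Q) are
      homotopic for parallel P and Q.

    - The path of [W] for a rule [u] says that the square with sides the edge of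
      [u], phi (psi u), and Lambda at both ends commutes up to [sim].
      Multiplying by words on both sides, which only costs the interchange law
      for paths acting on disjoint factors ([path_interchange]), gives such a
      square for every edge ([lambda_natural_edge]); pasting gives one for every
      path P from w to w' ([lambda_natural]), so that P is homotopic to
      Lambda_w phi(psi P) Lambda_w'^-1.

    Parallel paths P and Q are thus homotopic, because the same Lambda_w and
    Lambda_w'^-1 surround the homotopic paths phi (psi P) and phi (psi Q)
    ([parallel_sim]).  Conversely a homotopy relation generated by closed paths
    stays inside parallelism, which is a homotopy relation
    ([parallel_homotopy_relation]). *)

Set Implicit Arguments.
Unset Strict Implicit.
Unset Printing Implicit Defensive.

(** * Paths as lists of edges *)

Section Paths.
Variable A : Type.
Implicit Types (x y w : seq A) (s t : seq (edge A)) (E : edge A).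

(** A path is handled below as an initial vertex [w] together with a list of
    edges [s], and [composable R w s]: then juxtaposition is [++], and the
    identities between composite paths are identities between lists.  The
    three operations agree by conversion with [p_tau], with the edges of
    [p_inv] and with the edges of [p_ctx]. *)
Definition target w s : seq A := last w (map (@e_tau A) s).
Definition einv s : seq (edge A) := rev (map (@e_inv A) s).
Definition ectx x s y : seq (edge A) := [seq e_ctx x E y | E <- s].

Lemma e_iota_ctx x E y : e_iota (e_ctx x E y) = x ++ e_iota E ++ y.
Proof. by rewrite /e_iota /= -!catA. Qed.

Lemma e_tau_ctx x E y : e_tau (e_ctx x E y) = x ++ e_tau E ++ y.
Proof. by rewrite /e_tau /= -!catA. Qed.

Lemma e_iota_inv E : e_iota (e_inv E) = e_tau E.
Proof. by []. Qed.

Lemma e_tau_inv E : e_tau (e_inv E) = e_iota E.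
Proof. by rewrite /e_tau /= negbK. Qed.

Lemma e_invK : involutive (@e_inv A).
Proof. by case=> *; rewrite /e_inv /= negbK. Qed.

Lemma e_ctx_ctx x x' E y y' :
  e_ctx x (e_ctx x' E y') y = e_ctx (x ++ x') E (y' ++ y).
Proof. by rewrite /e_ctx /= !catA. Qed.

Lemma e_ctx0 E : e_ctx [::] E [::] = E.
Proof. by case: E => *; rewrite /e_ctx /= cats0. Qed.

Lemma einvK : involutive einv.
Proof. by move=> s; rewrite /einv map_rev revK mapK //; exact: e_invK. Qed.

Lemma einv_cons E s : einv (E :: s) = einv s ++ [:: e_inv E].
Proof. by rewrite /einv /= rev_cons cats1. Qed.

Lemma einv_cat s t : einv (s ++ t) = einv t ++ einv s.
Proof. by rewrite /einv map_cat rev_cat. Qed.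

Lemma einv_ctx x s y : einv (ectx x s y) = ectx x (einv s) y.
Proof. by rewrite /einv /ectx map_rev -!map_comp. Qed.

Lemma ectx_cat x s t y : ectx x (s ++ t) y = ectx x s y ++ ectx x t y.
Proof. exact: map_cat. Qed.

Lemma ectx_ctx x x' s y y' :
  ectx x (ectx x' s y') y = ectx (x ++ x') s (y' ++ y).
Proof.
by rewrite /ectx -map_comp; apply: eq_map => E; exact: e_ctx_ctx.
Qed.

Lemma ectx0 s : ectx [::] s [::] = s.
Proof. by rewrite -[RHS]map_id; apply: eq_map => E; exact: e_ctx0. Qed.

Lemma target_cons w E s : target w (E :: s) = target (e_tau E) s.
Proof. by []. Qed.

Lemma target_cat w s t : target w (s ++ t) = target (target w s) t.
Proof. by rewrite /target map_cat last_cat. Qed.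

Lemma target_ctx x w s y :
  target (x ++ w ++ y) (ectx x s y) = x ++ target w s ++ y.
Proof. by elim: s w => //= E s IH w; rewrite !target_cons e_tau_ctx IH. Qed.

Variable R : set (rule A).
Hypothesis Rpres : semigroup_presentation R.

Lemma e_iota_neq0 E : R (e_rule E) -> e_iota E <> [::].
Proof.
case: E => [x [u v] b y] /Rpres /= [u0 v0]; rewrite /e_iota /=.
by case: x b u u0 v v0 => // -[] [|? ?] // _ [|? ?].
Qed.

Lemma e_tau_neq0 E : R (e_rule E) -> e_tau E <> [::].
Proof. by move=> RE; rewrite -e_iota_inv; exact: e_iota_neq0. Qed.

Lemma composable_cat w s t :
  composable R w (s ++ t) <-> composable R w s /\ composable R (target w s) t.
Proof.
elim: s w => [|E s IH] w /=; first by split=> [|[]].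
split=> [[RE <- /IH[]]|[[RE <- cs] ct]]; first by [].
by split=> //; apply/IH.
Qed.

Lemma composable_ctx x w s y :
  composable R w s -> composable R (x ++ w ++ y) (ectx x s y).
Proof.
elim: s w => //= E s IH w [RE <- cs]; rewrite e_iota_ctx; split=> //.
by rewrite e_tau_ctx; exact: IH.
Qed.

Lemma target_neq0 w s : w <> [::] -> composable R w s -> target w s <> [::].
Proof.
elim: s w => //= E s IH w _ [RE _ cs]; rewrite target_cons.
by apply: IH cs; exact: e_tau_neq0.
Qed.

Lemma target_inv w s : composable R w s -> target (target w s) (einv s) = w.
Proof.
elim: s w => //= E s IH w [_ <- cs].
rewrite target_cons einv_cons target_cat IH //; exact: e_tau_inv.
Qed.

Lemma composable_inv w s :
  composable R w s -> composable R (target w s) (einv s).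
Proof.
elim: s w => //= E s IH w [RE <- cs]; rewrite einv_cons target_cons.
apply/composable_cat; split; first exact: IH.
by rewrite target_inv.
Qed.

Lemma cat3_neq0 x w y : w <> [::] -> x ++ w ++ y <> [::].
Proof. by case: x => //; case: w. Qed.

(** Parallelism is itself a homotopy relation.  So a relation generated by
    closed paths can never leave it, and only the converse inclusion has to be
    proved for a homotopy base. *)
Lemma parallel_homotopy_relation : homotopy_relation R (parallel R).
Proof.
split.
- by [].
- by move=> P pP; split.
- by move=> P Q [*]; split.
- move=> P Q T [pP pQ i t] [_ pT i' t'].
  by split=> //; [rewrite i | rewrite t].
- move=> E1 E2 R1 R2.
  have n1 := e_iota_neq0 R1; have n2 := e_iota_neq0 R2.
  have n3 := e_tau_neq0 R1.
  rewrite /p_cat /p_ctx /=.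
  split; rewrite /is_path /= ?e_iota_ctx ?e_tau_ctx /= ?cats0 //.
  + split; last by split.
    by move: (e_iota E1) n1 => [].
  + split; last by split.
    by move: (e_iota E1) n1 => [].
  + by rewrite /p_tau /= !e_tau_ctx /= cats0.
- move=> x y [w s] [w' t] [[/= w0 cs] [/= w'0 ct] /= ei et]; subst w'.
  split=> //; last first.
  + change (target (x ++ w ++ y) (ectx x s y) = target (x ++ w ++ y) (ectx x t y)).
    by rewrite !target_ctx; congr (_ ++ (_ ++ _)).
  + by split; [exact: cat3_neq0 | exact: composable_ctx].
  + by split; [exact: cat3_neq0 | exact: composable_ctx].
- move=> [wT sT] [wZ sZ] [w s] [w' t] [[/= w0 cs] [/= w'0 ct] /= ei et].
  move=> [/= wT0 cT] [/= wZ0 cZ] eT eZ; subst w'.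
  change (target w s = target w t) in et.
  change (target wT sT = w) in eT; change (target w s = wZ) in eZ.
  rewrite /p_cat /=; split; rewrite /is_path /=.
  + split=> //; apply/composable_cat; split.
      by apply/composable_cat; split=> //; rewrite eT.
    by rewrite target_cat eT eZ.
  + split=> //; apply/composable_cat; split.
      by apply/composable_cat; split=> //; rewrite eT.
    by rewrite target_cat eT -et eZ.
  + by [].
  + change (target wT ((sT ++ s) ++ sZ) = target wT ((sT ++ t) ++ sZ)).
    by rewrite !target_cat eT et.
- move=> [w s] [/= w0 cs]; rewrite /p_cat /p_inv /=.
  split; rewrite /is_path /=; try by split.
  + split=> //; apply/composable_cat; split=> //; exact: composable_inv.
  + change (target w (s ++ einv s) = w).
    by rewrite target_cat; exact: target_inv cs.
Qed.

(** * Calculus of a homotopy relation *)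

Variable sim : dpath A -> dpath A -> Prop.
Hypothesis simP : homotopy_relation R sim.

Definition homotopic w s t : Prop := sim (DPath w s) (DPath w t).

Lemma hom_path w s t : homotopic w s t ->
  [/\ w <> [::], composable R w s, composable R w t
    & target w s = target w t].
Proof. by case/(hr_parallel simP) => -[/= w0 cs] [_ /= ct] _. Qed.

Lemma hom_refl w s : w <> [::] -> composable R w s -> homotopic w s s.
Proof. by move=> w0 cs; exact: (hr_refl simP (P := DPath w s)). Qed.

Lemma hom_sym w s t : homotopic w s t -> homotopic w t s.
Proof. exact: (hr_sym simP (P := DPath w s)). Qed.

Lemma hom_trans t w s s' : homotopic w s t -> homotopic w t s' -> homotopic w s s'.
Proof. exact: (hr_trans simP (Q := DPath w t)). Qed.

Lemma hom_ctx x y w s t :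
  homotopic w s t -> homotopic (x ++ w ++ y) (ectx x s y) (ectx x t y).
Proof. exact: (hr_H2 simP x y (P := DPath w s)). Qed.

Lemma hom_cat w s s' t t' :
  homotopic w s s' -> homotopic (target w s) t t' -> homotopic w (s ++ t) (s' ++ t').
Proof.
move=> h k.
have [w0 cs cs' e] := hom_path h; have [w'0 ct ct' e'] := hom_path k.
apply: (@hom_trans (s' ++ t)).
- apply: (@hr_H3 _ _ _ simP (DPath w [::]) (DPath (target w s) t) _ _ h);
    by split.
- rewrite e in k w'0 ct ct' e'.
  have := @hr_H3 _ _ _ simP (DPath w s') (DPath (target (target w s') t) [::]) _ _ k.
  rewrite /p_cat /= !cats0; apply; rewrite // /is_path /=; split=> //.
  exact: target_neq0.
Qed.

Lemma hom_catl w s t t' : w <> [::] -> composable R w s ->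
  homotopic (target w s) t t' -> homotopic w (s ++ t) (s ++ t').
Proof. by move=> w0 cs; apply: hom_cat; exact: hom_refl. Qed.

Lemma hom_catr w s s' t : homotopic w s s' -> composable R (target w s) t ->
  homotopic w (s ++ t) (s' ++ t).
Proof.
move=> h ct; apply: (hom_cat h); have [w0 cs _ _] := hom_path h.
by apply: hom_refl => //; exact: target_neq0.
Qed.

Lemma hom_invr w s : w <> [::] -> composable R w s -> homotopic w (s ++ einv s) [::].
Proof. by move=> w0 cs; apply: (hr_H4 simP (P := DPath w s)). Qed.

Lemma hom_invl w s : w <> [::] -> composable R w s ->
  homotopic (target w s) (einv s ++ s) [::].
Proof.
move=> w0 cs; have /= := @hom_invr (target w s) (einv s).
by rewrite einvK; apply; [exact: target_neq0 | exact: composable_inv].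
Qed.

(** This turns the closed paths of a generating set into the equations between
    parallel paths that they express. *)
Lemma hom_eq_of_loop w s t : composable R w t -> target w s = target w t ->
  homotopic w (s ++ einv t) [::] -> homotopic w s t.
Proof.
move=> ct e h; have [w0 /composable_cat[cs _] _ _] := hom_path h.
apply: (@hom_trans (s ++ (einv t ++ t))).
  rewrite -[X in homotopic w X _]cats0; apply: hom_catl => //.
  by rewrite e; apply/hom_sym/hom_invl.
rewrite catA -[X in homotopic w _ X]cat0s; apply: hom_catr => //.
by rewrite target_cat e target_inv.
Qed.

Lemma hom_cancelr w s t b : homotopic w (s ++ b) (t ++ b) -> homotopic w s t.
Proof.
move=> h; have [w0 /composable_cat[cs cb] /composable_cat[ct cb'] _] := hom_path h.
have loop u : composable R w u -> composable R (target w u) b ->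
    homotopic w u ((u ++ b) ++ einv b).
  move=> cu cub; rewrite -catA -[X in homotopic w X _]cats0.
  apply: hom_catl => //; apply: hom_sym; apply: hom_invr => //.
  exact: target_neq0.
apply: (hom_trans (loop _ cs cb)); apply: (@hom_trans ((t ++ b) ++ einv b)).
  by apply: (hom_catr h); rewrite target_cat; exact: composable_inv.
by apply: hom_sym; exact: loop.
Qed.

(** (H1) for an edge and a path: the edge is moved past the edges of the path
    one at a time. *)
Lemma edge_path_interchange x y E t : R (e_rule E) -> e_iota E = x ->
  composable R y t ->
  homotopic (x ++ y) (e_ctx [::] E y :: ectx (e_tau E) t [::])
               (ectx x t [::] ++ [:: e_ctx [::] E (target y t)]).
Proof.
move=> RE <- {x}; elim: t y => [|F t IH] y /=.
  move=> _; apply: hom_refl => /=.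
    by move: (e_iota E) (e_iota_neq0 RE) => [].
  by split=> //; rewrite e_iota_ctx.
case=> RF <- ct; rewrite target_cons.
have h : homotopic (e_iota E ++ e_iota F)
    [:: e_ctx [::] E (e_iota F); e_ctx (e_tau E) F [::]]
    [:: e_ctx (e_iota E) F [::]; e_ctx [::] E (e_tau F)].
  by have := hr_H1 simP RE RF; rewrite /p_cat /p_ctx /homotopic /= cats0.
have [n0 [_ _ [_ _ _]] [_ eF _] _] := hom_path h.
have ct' x : composable R (x ++ e_tau F) (ectx x t [::]).
  by have := composable_ctx x [::] ct; rewrite cats0.
apply: (@hom_trans ([:: e_ctx (e_iota E) F [::]; e_ctx [::] E (e_tau F)]
                    ++ ectx (e_tau E) t [::])).
  apply: (hom_catr h) => //.
  by rewrite /target /= e_tau_ctx cats0.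
apply: (@hom_catl _ [:: e_ctx (e_iota E) F [::]]) => //.
have := IH _ ct; rewrite /target /= e_tau_ctx cats0; exact.
Qed.

(** (H1) for two paths acting on disjoint parts of a word, by moving the edges
    of [s] one at a time past the whole of [t].  Either of [x] and [y] may be
    empty; only the word on which both paths act has to be a vertex. *)
Lemma path_interchange x y s t : x ++ y <> [::] ->
  composable R x s -> composable R y t ->
  homotopic (x ++ y) (ectx [::] s y ++ ectx (target x s) t [::])
               (ectx x t [::] ++ ectx [::] s (target y t)).
Proof.
move=> xy0 cs ct; elim: s x cs xy0 => [|E s IH] x /=.
  move=> _ xy0; rewrite cats0 /target /=; apply: hom_refl => //.
  by have := composable_ctx x [::] ct; rewrite cats0.
case=> RE ex cs xy0; rewrite target_cons.
have n0 : e_tau E ++ y <> [::] by move: (e_tau E) (e_tau_neq0 RE) => [].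
have h := edge_path_interchange RE ex ct; have [_ [_ eE _] _ e] := hom_path h.
apply: (@hom_trans (e_ctx [::] E y :: (ectx (e_tau E) t [::] ++
                      ectx [::] s (target y t)))).
  apply: (@hom_catl _ [:: e_ctx [::] E y]) => //.
  by rewrite /target /= e_tau_ctx; exact: IH.
rewrite -[e_ctx [::] E (target y t) :: _]cat1s -cat_cons catA.
apply: (hom_catr h).
rewrite target_cons e_tau_ctx /=.
have := target_ctx (e_tau E) y t [::]; rewrite !cats0 => ->.
exact: (composable_ctx [::] _ cs).
Qed.

(** The homotopy between the two ways round the square

      [w  --a-->  .]
      [s|         |t]
      [.  --b-->  .]

    is the first hypothesis; the second is a square below it with the common
    side [b], and they paste to the rectangle with outer sides [a], [t ++ t'],
    [s ++ b'] and [c]. *)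
Lemma square_paste w a b s t t' b' c :
  homotopic w (a ++ t) (s ++ b) -> homotopic (target w s) (b ++ t') (b' ++ c) ->
  homotopic w (a ++ (t ++ t')) ((s ++ b') ++ c).
Proof.
move=> h k; have [w0 c1 /composable_cat[c2 c3] e] := hom_path h.
have [_ /composable_cat[c4 c5] _ _] := hom_path k.
apply: (@hom_trans (s ++ (b ++ t'))); last by rewrite -catA; exact: hom_catl.
by rewrite !catA; apply: (hom_catr h); rewrite e target_cat.
Qed.

(** Reversing the two opposite sides [s] and [t] of a square gives a square, so
    that naturality for an edge yields naturality for the inverse edge. *)
Lemma square_inv w s a' a t :
  homotopic w (s ++ a') (a ++ t) ->
  homotopic (target w s) (einv s ++ a) (a' ++ einv t).
Proof.
move=> h; have [w0 /composable_cat[cs ca'] /composable_cat[ca ct]] := hom_path h.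
rewrite !target_cat => e.
have ws0 := target_neq0 w0 cs; have wa0 := target_neq0 w0 ca.
have cis := composable_inv cs; have cit := composable_inv ct.
have ts := target_inv cs.
apply: (@hom_trans (einv s ++ (a ++ (t ++ einv t)))).
  apply: hom_catl => //; rewrite ts -[X in homotopic _ X _]cats0.
  by apply: hom_catl => //; apply: hom_sym; exact: hom_invr.
apply: (@hom_trans (einv s ++ ((s ++ a') ++ einv t))).
  apply: hom_catl => //; rewrite ts catA; apply: hom_sym.
  by apply: (hom_catr h); rewrite target_cat e.
rewrite -catA catA -[X in homotopic _ _ X]cat0s; apply: hom_catr.
  exact: hom_invl.
rewrite target_cat ts; apply/composable_cat; split=> //.
by rewrite e.
Qed.

End Paths.

(** * The action on the cosets *)

Section Action.
Variables (S : semigroupType) (G : set S) (I : Type) (C : I -> set S) (i1 : I).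
Hypothesis Cidx : coset_indexing G C i1.

Lemma rtranslateM (D : set S) s t :
  rtranslate (rtranslate D s) t = rtranslate D (s * t)%g.
Proof.
rewrite /rtranslate image_comp; congr image.
by apply: funext => g /=; rewrite mulgA.
Qed.

Lemma act_Some i s j : act C (Some i) s = Some j <-> C j = rtranslate (C i) s.
Proof.
have [Cinj _ _] := Cidx; rewrite /act; case: pselect => [ex|nex]; last first.
  by split=> // e; case: nex; exists j.
case: (cid _) => /= k ek; split=> [[<-] //|ej].
by congr Some; apply: Cinj; rewrite ej.
Qed.

Lemma act_None i s : act C (Some i) s = None <-> forall j, C j <> rtranslate (C i) s.
Proof.
split=> [e j /act_Some|n]; first by rewrite e.
by case e: (act _ _ _) => [j|//]; have /act_Some/n := e.
Qed.

(** Associativity holds even at zero because coset-ness is inherited by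
    prefixes: if [(C_i s) t] is a coset, some [s'] brings it back to [G], and
    then [t s'] brings [C_i s] back to [G]. *)
Lemma actM oi s t : act C oi (s * t)%g = act C (act C oi s) t.
Proof.
case: oi => [i|//]; case e: (act C (Some i) s) => [j|].
  move/act_Some in e; case f: (act C (Some j) t) => [k|].
    by apply/act_Some; move/act_Some in f; rewrite -rtranslateM -e.
  by apply/act_None => k; rewrite -rtranslateM -e; move: k; exact/act_None.
apply/act_None => j; rewrite -rtranslateM => ej.
have [_ cosetP _] := Cidx.
have /cosetP[s0 e0 _] : exists i', C i' = C i by exists i.
have /cosetP[_ _ [s' es']] : exists j', C j' = C j by exists j.
have /cosetP[k ek] : is_coset G (rtranslate (C i) s).
  exists (s0 * s)%g; first by rewrite e0 rtranslateM.
  by exists (t * s')%g; rewrite -[RHS]es' ej e0 !rtranslateM !mulgA.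
by move/act_None: e => /(_ k).
Qed.

End Action.

(** * The map phi on words, edges and paths *)

Section PhiPsi.
Variables (A : Type) (R : set (rule A)) (S : semigroupType) (pi : seq A -> S).
Variables (G : set S) (I : Type) (C : I -> set S) (i1 : I).
Hypothesis Rpres : semigroup_presentation R.
Hypothesis Sdef : semigroup_defined_by R pi.
Hypothesis Cidx : coset_indexing G C i1.

Local Notation run := (actw pi C).
Local Notation ph := (phi pi C).
Local Notation phE := (phi_edge pi C).

Lemma run_None w : run None w = None.
Proof. by case: w. Qed.

Lemma run_cat oi u v : run oi (u ++ v) = run (run oi u) v.
Proof.
case: u => [//|a u]; case: v => [|b v]; first by rewrite cats0.
have [pi_cat _ _] := Sdef.
rewrite [LHS](_ : _ = act C oi (pi ((a :: u) ++ b :: v))) //.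
by rewrite pi_cat // (actM Cidx).
Qed.

Lemma run_prefix oi u v : run oi (u ++ v) <> None -> run oi u <> None.
Proof. by rewrite run_cat => + e; rewrite e run_None. Qed.

Lemma phi_cons i a w : run (Some i) [:: a] <> None ->
  exists2 b, val b = (i, a) &
    ph (Some i) (a :: w) = b :: ph (run (Some i) [:: a]) w.
Proof.
move=> n; have s : isSome (run (Some i) [:: a]) by case: (run _ _) n.
exists (Sub (i, a) s : letter pi C) => //.
by rewrite [LHS]/=; rewrite insubT.
Qed.

Lemma phi_cat oi u v : run oi u <> None ->
  ph oi (u ++ v) = ph oi u ++ ph (run oi u) v.
Proof.
elim: u oi => [//|a u IH] [i|]; last by rewrite run_None.
rewrite -cat1s run_cat => n.
have na : run (Some i) [:: a] <> None by move=> e; rewrite e run_None in n.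
have [b vb /= ->] := phi_cons (u ++ v) na.
have [b' vb' /= ->] := phi_cons u na.
by rewrite (IH _ n); congr cons; apply: val_inj; rewrite vb vb'.
Qed.

Lemma phi_neq0 oi w : w <> [::] -> run oi w <> None -> ph oi w <> [::].
Proof.
case: oi w => [i|] [|a w] // _.
by move=> /(@run_prefix _ [:: a]) /(phi_cons w)[b _ ->].
Qed.

(** The two sides of a rule act alike since they represent the same element;
    hence a whole path of the graph of [R] fixes the index reached, and phi
    never meets the zero along a path that starts outside it. *)
Lemma run_rule oi q : R q -> run oi q.1 = run oi q.2.
Proof.
move=> Rq; have [n1 n2] := Rpres Rq; have [_ _ pi_eq] := Sdef.
have /(pi_eq _ _ n1 n2) := cong_rule Rq.
by case: q.1 n1 => // ? ? _; case: q.2 n2 => // ? ? _ /= ->.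
Qed.

Lemma run_side oi (E : edge A) b : R (e_rule E) ->
  run oi (e_left E ++ side (e_rule E) b) = run oi (e_left E ++ (e_rule E).1).
Proof.
by move=> RE; rewrite !run_cat; case: b => //=; rewrite (run_rule _ RE).
Qed.

Lemma run_edge oi (E : edge A) : R (e_rule E) ->
  run oi (e_tau E) = run oi (e_iota E).
Proof.
by move=> RE; rewrite /e_tau /e_iota !catA !(run_cat _ (_ ++ _)) !run_side.
Qed.

Lemma run_target oi w s : composable R w s -> run oi (target w s) = run oi w.
Proof.
elim: s w => //= E s IH w [RE <- cs].
by rewrite target_cons IH // run_edge.
Qed.

Lemma phi_edge_iota oi (E : edge A) : R (e_rule E) ->
  run oi (e_iota E) <> None -> e_iota (phE oi E) = ph oi (e_iota E).
Proof.
case: E => l q b y; rewrite /e_iota /= => Rq n.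
have nl := run_prefix n.
have nq : run (run oi l) (side q b) <> None.
  by rewrite -run_cat; apply: (@run_prefix _ _ y); rewrite -catA.
rewrite (phi_cat _ nl) (phi_cat _ nq) -run_cat.
by rewrite (run_side oi (E := Edge l q b y) b Rq); case: b {n nq}.
Qed.

Lemma phi_edge_tau oi (E : edge A) : R (e_rule E) ->
  run oi (e_iota E) <> None -> e_tau (phE oi E) = ph oi (e_tau E).
Proof.
move=> RE n; rewrite -!e_iota_inv -(phi_edge_iota (E := e_inv E)) //.
by rewrite e_iota_inv run_edge.
Qed.

(** This makes phi of a path in context a path in context: the part of the word
    to the right of the path is always read from the same index. *)
Lemma phi_edge_ctx oi x (E : edge A) y : R (e_rule E) ->
  run oi (x ++ e_iota E ++ y) <> None ->
  phE oi (e_ctx x E y) =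
  e_ctx (ph oi x) (phE (run oi x) E) (ph (run oi (x ++ e_iota E)) y).
Proof.
move=> RE n; rewrite /phi_edge /e_ctx /=.
have nx := run_prefix n.
have nxe : run (run oi x) (e_iota E) <> None.
  by rewrite -run_cat; apply: (@run_prefix _ _ y); rewrite -catA.
have nl : run (run oi x) (e_left E) <> None := run_prefix nxe.
have e1 : run oi ((x ++ e_left E) ++ (e_rule E).1)
        = run (run oi x) (e_left E ++ (e_rule E).1) by rewrite -catA run_cat.
have e2 : run (run (run oi x) (e_left E ++ (e_rule E).1)) (e_right E)
        = run oi (x ++ e_iota E).
  by rewrite [RHS]run_cat /e_iota catA [RHS]run_cat run_side.
have nr : run (run (run oi x) (e_left E ++ (e_rule E).1)) (e_right E) <> None.
  by rewrite e2 run_cat.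
by rewrite e1 phi_cat // run_cat (phi_cat _ nr) e2.
Qed.

Lemma phi_ectx oi x w s y : composable R w s ->
  run oi (x ++ w ++ y) <> None ->
  map (phE oi) (ectx x s y) =
  ectx (ph oi x) (map (phE (run oi x)) s) (ph (run oi (x ++ w)) y).
Proof.
elim: s w => //= E s IH w [RE <- cs] n; rewrite phi_edge_ctx //.
congr cons; have ee : run oi (x ++ e_tau E) = run oi (x ++ e_iota E).
  by rewrite run_cat [RHS]run_cat run_edge.
by rewrite (IH _ cs) ?ee // catA run_cat ee -run_cat -catA.
Qed.

Lemma map_phi_inv oi s : map (phE oi) (einv s) = einv (map (phE oi) s).
Proof. by rewrite /einv map_rev -!map_comp. Qed.

Variables (r r' : I -> seq A) (e : seq A).
Local Notation U := (relsU pi C i1 r r' e R).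

Lemma phi_edge_rule oi (E : edge A) : R (e_rule E) ->
  run oi (e_iota E) <> None -> U (e_rule (phE oi E)).
Proof.
rewrite /e_iota catA => RE /run_prefix; rewrite run_side // run_cat => n.
left; case ej: (run oi (e_left E)) n => [j|]; last by rewrite run_None.
by move=> n; exists j, (e_rule E); rewrite /phi_edge /= ej.
Qed.

Lemma phi_composable oi w s : composable R w s -> run oi w <> None ->
  composable U (ph oi w) (map (phE oi) s).
Proof.
elim: s w => //= E s IH w [RE <- cs] n; split.
- exact: phi_edge_rule.
- exact: phi_edge_iota.
- by rewrite phi_edge_tau //; apply: IH => //; rewrite run_edge.
Qed.

Lemma target_phi oi w s : composable R w s -> run oi w <> None ->
  target (ph oi w) (map (phE oi) s) = ph oi (target w s).
Proof.
elim: s w => //= E s IH w [RE <- cs] n.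
by rewrite !target_cons phi_edge_tau // IH // run_edge.
Qed.

Lemma phi_is_path oi P : is_path R P -> run oi (p_iota P) <> None ->
  is_path U (phi_path pi C oi P).
Proof.
case=> w0 cs n; split; first exact: phi_neq0.
exact: phi_composable.
Qed.

(** * Pulling a homotopy relation back along phi *)

Section Pullback.
Variable sim : dpath (letter pi C) -> dpath (letter pi C) -> Prop.
Hypothesis simP : homotopy_relation U sim.

(** All starting indices are needed at once: in (H2) a left context [x] changes
    the index from which the path is read. *)
Definition phi_pullback (P Q : dpath A) : Prop :=
  parallel R P Q /\
  forall oi, run oi (p_iota P) <> None ->
    sim (phi_path pi C oi P) (phi_path pi C oi Q).

Lemma phi_pullback_homotopy : homotopy_relation R phi_pullback.
Proof.
have par := parallel_homotopy_relation Rpres.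
split.
- by move=> P Q [].
- move=> P pP; split; first exact: (hr_refl par).
  by move=> oi n; apply: (hr_refl simP); exact: phi_is_path.
- move=> P Q [pq h]; split; first exact: (hr_sym par).
  by move=> oi; have [_ _ <- _] := pq => /h; exact: (hr_sym simP).
- move=> P Q T [pq h] [qt k]; split; first exact: (hr_trans par pq qt).
  move=> oi n; apply: (hr_trans simP (h oi n)); apply: k.
  by have [_ _ <- _] := pq.
- move=> E1 E2 R1 R2; split; first exact: (hr_H1 par).
  move=> oi /= n.
  have n1 : run oi (e_iota E1) <> None := run_prefix n.
  have ne : run oi (e_tau E1) = run oi (e_iota E1) by rewrite run_edge.
  have n2 : run (run oi (e_iota E1)) (e_iota E2) <> None by rewrite -run_cat.
  have n3 : run (run oi (e_iota E1)) (e_tau E2) <> None by rewrite run_edge.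
  have RU1 := phi_edge_rule R1 n1; have RU2 := phi_edge_rule R2 n2.
  have := hr_H1 simP RU1 RU2.
  rewrite /p_cat /p_ctx /phi_path /= !phi_edge_iota // !phi_edge_tau //.
  have n4 : run oi (e_iota E1 ++ e_tau E2) <> None by rewrite run_cat.
  have n5 : run oi (e_iota E1 ++ e_iota E2 ++ [::]) <> None by rewrite cats0.
  have n6 : run oi (e_tau E1 ++ e_iota E2 ++ [::]) <> None.
    by rewrite cats0 run_cat ne.
  by rewrite !phi_edge_ctx //= !cats0 ne phi_cat.
- move=> x y P Q [pq h]; split; first exact: (hr_H2 par).
  move=> oi /= n; have [[_ cP] [_ cQ] ei _] := pq.
  have nx := run_prefix n.
  have nxP : run (run oi x) (p_iota P) <> None.
    by rewrite -run_cat; apply: (@run_prefix _ _ y); rewrite -catA.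
  have := hr_H2 simP (ph oi x) (ph (run oi (x ++ p_iota P)) y) (h _ nxP).
  rewrite /phi_path /p_ctx /= -!/(ectx _ _ _).
  rewrite (phi_ectx cP n) (phi_ectx cQ) -?ei //.
  by rewrite (phi_cat _ nx) (phi_cat _ nxP) -run_cat.
- move=> T Z P Q [pq h] pT pZ eT eZ; split; first exact: (hr_H3 par).
  move=> oi /= n; have [pP _ ei et] := pq.
  have nP : run oi (p_iota P) <> None.
    by rewrite -eT; rewrite [run _ _](run_target _ pT.2).
  have nZ : run oi (p_iota Z) <> None.
    by rewrite -eZ; rewrite [run _ _](run_target _ pP.2).
  have := hr_H3 simP (h _ nP) (phi_is_path pT n) (phi_is_path pZ nZ).
  rewrite /phi_path /p_cat /= !map_cat; apply.
    by rewrite -eT; exact: target_phi pT.2 n.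
  by rewrite -eZ; exact: target_phi pP.2 nP.
- move=> P pP; split; first exact: (hr_H4 par).
  move=> oi n; have := hr_H4 simP (phi_is_path pP n).
  by rewrite /phi_path /p_cat /= map_cat [map _ (rev _)](map_phi_inv oi).
Qed.

(** The pullback contains the homotopy base [X] as soon as [sim] contains [K], so
    it contains all parallel pairs. *)
Lemma phi_parallel_sim (X : set (dpath A)) : homotopy_base R X ->
  (forall Z, baseK pi C X Z -> sim Z (p_one (p_iota Z))) ->
  forall P Q oi, parallel R P Q -> run oi (p_iota P) <> None ->
  sim (phi_path pi C oi P) (phi_path pi C oi Q).
Proof.
move=> [Xcl Xbase] simK P Q oi /Xbase PQ n.
have [|_] := PQ _ phi_pullback_homotopy; last exact.
move=> Z XZ; have [pZ eZ] := Xcl _ XZ; split.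
  by split=> //; split=> //; exact: pZ.1.
case=> [j|]; last by rewrite run_None.
by move=> nj; apply: simK; exists Z, j.
Qed.

End Pullback.

(** * The map psi *)

Hypothesis rep : coset_representatives pi C G i1 r r'.
Hypothesis e0 : e <> [::].
Hypothesis e_id : is_identity_of G (pi e).

Local Notation ps := (psi (pi := pi) (C := C) r r' e).
Local Notation psl := (psi_letter (pi := pi) (C := C) r r' e).
Local Notation phipsi w := (ph (Some i1) (ps w)).

Lemma run_act oi w : w <> [::] -> run oi w = act C oi (pi w).
Proof. by case: w. Qed.

Lemma run_e : run (Some i1) e = Some i1.
Proof.
rewrite run_act //; apply/(act_Some Cidx); have [_ _ ->] := Cidx.
apply/seteqP; split=> [g Gg|_ [g Gg <-]].
  by exists g => //; have [_ /(_ _ Gg)[]] := e_id.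
by have [_ /(_ _ Gg)[_ ->]] := e_id.
Qed.

Lemma run_r i : run (Some i1) (r i) = Some i.
Proof.
have [r1 _ rI] := rep.
have [->|/rI[n _ h _]] := pselect (i = i1); first by rewrite r1.
by rewrite run_act //; apply/(act_Some Cidx); have [_ _ ->] := Cidx.
Qed.

Lemma run_r' i : run (Some i) (r' i) = Some i1.
Proof.
have [_ r1 rI] := rep.
have [->|/rI[_ n h k]] := pselect (i = i1); first by rewrite r1.
rewrite run_act //; apply/(act_Some Cidx); have [_ _ ->] := Cidx.
rewrite -h rtranslateM; apply/seteqP; split=> [g Gg|_ [g Gg <-]].
  by exists g => //; rewrite mulgA k.
by rewrite mulgA k.
Qed.

(** The word of the letter [[i,a]] travels from the index of [G] through [i] and
    [ia] and back to the index of [G]; this is what makes phi after psi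
    multiplicative. *)
Lemma run_psi_letter b : run (Some i1) (psl b) = Some i1.
Proof.
case: b => -[i a] s; change (is_true (isSome (run (Some i) [:: a]))) in s.
change (run (Some i1) (e ++ r i ++ [:: a] ++ oapp r' [::] (run (Some i) [:: a]))
        = Some i1).
rewrite run_cat run_e run_cat run_r run_cat.
by case: (run _ _) s => // j _; exact: run_r'.
Qed.

Lemma run_psi w : run (Some i1) (ps w) = Some i1.
Proof. by elim: w => //= b w IH; rewrite run_cat run_psi_letter. Qed.

Lemma run_psi_neq0 w : run (Some i1) (ps w) <> None.
Proof. by rewrite run_psi. Qed.

Lemma psi_cat w w' : ps (w ++ w') = ps w ++ ps w'.
Proof. by rewrite /psi map_cat flatten_cat. Qed.

Lemma psi_letter_neq0 b : psl b <> [::].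
Proof. by rewrite /psi_letter; case: (val b) => i a; case: e e0. Qed.

Lemma psi_neq0 w : w <> [::] -> ps w <> [::].
Proof.
by case: w => // b w _; rewrite /psi /=; case: (psl b) (@psi_letter_neq0 b).
Qed.

Lemma phi_psi_cons b w : phipsi (b :: w) = ph (Some i1) (psl b) ++ phipsi w.
Proof. by rewrite /= phi_cat run_psi_letter. Qed.

Lemma U_pres : semigroup_presentation U.
Proof.
move=> u [[i [v [Rv n ->]]]|[b ->]] /=.
  have [n1 n2] := Rpres Rv.
  by split; apply: phi_neq0 => //; rewrite -(run_rule _ Rv).
by split=> //; apply: phi_neq0; [exact: psi_letter_neq0 | rewrite run_psi_letter].
Qed.

(** * The paths Lambda *)

Local Notation lam_path := (lambda (pi := pi) (C := C) i1 r r' e).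
Local Notation lam w := (p_edges (lam_path w)).
Local Notation letter_edge b := (Edge [::] ([:: b], ph (Some i1) (psl b)) true [::]).

Lemma lambda_cons b w : lam (b :: w) =
  e_ctx [::] (letter_edge b) w :: ectx (ph (Some i1) (psl b)) (lam w) [::].
Proof. by case: w. Qed.

Lemma lambda_composable w : composable U w (lam w).
Proof.
elim: w => // b w IH; rewrite lambda_cons /=; split.
- by right; exists b.
- by [].
- by have := composable_ctx (ph (Some i1) (psl b)) [::] IH; rewrite cats0.
Qed.

Lemma lambda_target w : target w (lam w) = phipsi w.
Proof.
elim: w => // b w IH; rewrite lambda_cons target_cons phi_psi_cons -IH.
by have := target_ctx (ph (Some i1) (psl b)) w (lam w) [::]; rewrite !cats0.
Qed.

(** Lambda of a product, as an equality of edge lists and not only up to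
    homotopy; it includes empty factors. *)
Lemma lambda_cat w w' :
  lam (w ++ w') = ectx [::] (lam w) w' ++ ectx (phipsi w) (lam w') [::].
Proof.
elim: w => [|b w IH]; first by rewrite ectx0.
rewrite cat_cons !lambda_cons IH phi_psi_cons ectx_cat !ectx_ctx cats0 [RHS]/=.
by rewrite -/(ectx _ _ _) ectx_ctx cats0 e_ctx_ctx.
Qed.

(** * The composite of phi and psi on paths *)

Variable psiE : rule (letter pi C) -> dpath A.
Hypothesis psiEP : psi_choice pi C i1 r r' e R psiE.

Local Notation Phi s := (map (phE (Some i1)) s).
Local Notation psE E := (p_edges (psi_edge r r' e psiE E)).
Definition psi_edges s := flatten [seq psE E | E <- s].

Lemma psi_edge_composable E : U (e_rule E) ->
  composable R (ps (e_iota E)) (psE E) /\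
  target (ps (e_iota E)) (psE E) = ps (e_tau E).
Proof.
case: E => x u b y /= Uu; rewrite /e_iota /e_tau /= !psi_cat /psi_edge /=.
have [] := psiEP Uu; case: (psiE u) => w s /= [_ cs] ew et; subst w.
change (target (ps u.1) s = ps u.2) in et.
rewrite /p_ctx /= -/(ectx _ _ _); case: b => /=; rewrite -?/(ectx _ _ _).
  by rewrite target_ctx et; split=> //; exact: composable_ctx.
rewrite -!/(einv _) -et target_ctx (target_inv cs); split=> //.
exact/composable_ctx/composable_inv.
Qed.

Lemma psi_edges_composable w s : composable U w s ->
  composable R (ps w) (psi_edges s) /\
  target (ps w) (psi_edges s) = ps (target w s).
Proof.
elim: s w => //= E s IH w [UE <- cs].
have [c1 t1] := psi_edge_composable UE; have [c2 t2] := IH _ cs.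
rewrite /psi_edges /= target_cat t1; split; last exact: t2.
by apply/composable_cat; rewrite t1.
Qed.

Lemma Phi_psi_edges w s : composable U w s ->
  composable U (phipsi w) (Phi (psi_edges s)) /\
  target (phipsi w) (Phi (psi_edges s)) = phipsi (target w s).
Proof.
move=> cs; have [c t] := psi_edges_composable cs.
split; first exact: (phi_composable c (@run_psi_neq0 w)).
by rewrite (target_phi c (@run_psi_neq0 w)) t.
Qed.

Lemma psi_path_parallel P Q : parallel U P Q ->
  parallel R (psi_path r r' e psiE P) (psi_path r r' e psiE Q).
Proof.
case: P Q => [w s] [w' t] [[/= w0 cs] [/= w'0 ct] /= ei et]; subst w'.
change (target w s = target w t) in et.
have [c1 t1] := psi_edges_composable cs; have [c2 t2] := psi_edges_composable ct.
split; rewrite /is_path /= -?/(psi_edges _) //.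
- by split=> //; exact: psi_neq0.
- by split=> //; exact: psi_neq0.
- change (target (ps w) (psi_edges s) = target (ps w) (psi_edges t)).
  by rewrite t1 t2 et.
Qed.

Lemma psi_edges_rule u : psi_edges [:: rule_edge u] = p_edges (psiE u).
Proof. by rewrite /psi_edges /= cats0 -/(ectx _ _ _) ectx0. Qed.

Lemma Phi_psi_edge_pos x u y : U u ->
  Phi (psE (Edge x u true y)) = ectx (phipsi x) (Phi (p_edges (psiE u))) (phipsi y).
Proof.
move=> Uu; have [[_ cu] eu _] := psiEP Uu; rewrite eu in cu.
rewrite /psi_edge /= -/(ectx _ _ _) (phi_ectx cu).
  by rewrite run_cat !run_psi.
by rewrite -!psi_cat run_psi.
Qed.

Lemma psi_edge_inv E : psE (e_inv E) = einv (psE E).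
Proof.
case: E => x u b y; set s := p_edges (psiE u).
case: b; first exact/esym/(einv_ctx (ps x) s (ps y)).
change (ectx (ps x) s (ps y) = einv (ectx (ps x) (einv s) (ps y))).
by rewrite einv_ctx einvK.
Qed.

Lemma pathWE u : pathW i1 r r' e psiE u =
  DPath u.1 ((rule_edge u :: lam u.2) ++
             einv (lam u.1 ++ Phi (p_edges (psiE u)))).
Proof.
have eu : e_iota (rule_edge u) = u.1 by rewrite /e_iota /= cats0.
by rewrite -psi_edges_rule einv_cat catA -[X in _ = DPath X _]eu.
Qed.

(** The path of [W] for the rule [u] runs around a square: these are its two
    ways from [u.1] to the far corner. *)
Lemma rule_square_sides u : U u ->
  [/\ u.1 <> [::], composable U u.1 (rule_edge u :: lam u.2),
     composable U u.1 (lam u.1 ++ Phi (p_edges (psiE u)))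
   & target u.1 (rule_edge u :: lam u.2) =
     target u.1 (lam u.1 ++ Phi (p_edges (psiE u)))].
Proof.
move=> Uu; have [n1 n2] := U_pres Uu.
have ci : composable U u.1 [:: rule_edge u].
  by split=> //; rewrite /e_iota /= cats0.
have ti : e_tau (rule_edge u) = u.2 by rewrite /e_tau /= cats0.
have [c t] := Phi_psi_edges ci; rewrite psi_edges_rule in c t.
split=> //.
- by have [? ? _] := ci; split=> //; rewrite ti; exact: lambda_composable.
- apply/composable_cat; split; first exact: lambda_composable.
  by rewrite lambda_target.
- rewrite target_cat lambda_target t target_cons ti lambda_target.
  by rewrite /target /= ti.
Qed.

Lemma pathW_closed u : U u -> closed_path U (pathW i1 r r' e psiE u).
Proof.
move=> Uu; have [n cs ct et] := rule_square_sides Uu; rewrite pathWE.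
split; first split=> //.
  apply/composable_cat; split=> //; rewrite et; exact: composable_inv.
change (u.1 = target u.1 ((rule_edge u :: lam u.2) ++
             einv (lam u.1 ++ Phi (p_edges (psiE u))))).
by rewrite target_cat et (target_inv ct).
Qed.

Lemma phi_path_closed oi P : closed_path R P -> run oi (p_iota P) <> None ->
  closed_path U (phi_path pi C oi P).
Proof.
move=> [pP eP] n; split; first exact: phi_is_path.
by rewrite /= {1}eP; apply/esym/(target_phi pP.2 n).
Qed.

(** * Naturality of Lambda and conclusion *)

Section Naturality.
Variable sim : dpath (letter pi C) -> dpath (letter pi C) -> Prop.
Hypothesis simP : homotopy_relation U sim.
Hypothesis simW : forall Z, baseW pi C i1 r r' e R psiE Z ->
  sim Z (p_one (p_iota Z)).

Lemma lambda_natural_rule u : U u ->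
  homotopic sim u.1 (rule_edge u :: lam u.2) (lam u.1 ++ Phi (p_edges (psiE u))).
Proof.
move=> Uu; have [n cs ct et] := rule_square_sides Uu.
apply: (hom_eq_of_loop U_pres simP) => //.
by have := simW (ex_intro2 _ _ u Uu erefl); rewrite pathWE.
Qed.

(** The rectangle for the edge [x u y] is pasted from three squares along the
    decomposition of Lambda over the factors [x], the side of [u] and [y].  The
    outer two are instances of interchange, the middle one is the element of
    [W] put in context. *)
Lemma lambda_natural_pos x u y : U u ->
  homotopic sim (x ++ u.1 ++ y)
    (Edge x u true y :: lam (x ++ u.2 ++ y))
    (lam (x ++ u.1 ++ y) ++ Phi (psE (Edge x u true y))).
Proof.
move=> Uu; have [n1 _ _ _] := rule_square_sides Uu.
have n : x ++ u.1 ++ y <> [::] by exact: cat3_neq0.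
have ci : composable U u.1 [:: rule_edge u].
  by split=> //; rewrite /e_iota /= cats0.
have ti : target u.1 [:: rule_edge u] = u.2 by rewrite /target /= /e_tau /= cats0.
have [cT tT] := Phi_psi_edges ci; rewrite psi_edges_rule ti in cT tT.
set T := Phi (p_edges (psiE u)) in cT tT.
(* [u] and the path Lambda at [x] act on disjoint factors. *)
have sx : homotopic sim (x ++ u.1 ++ y)
    (ectx x [:: rule_edge u] y ++ ectx [::] (lam x) (u.2 ++ y))
    (ectx [::] (lam x) (u.1 ++ y) ++ ectx (phipsi x) [:: rule_edge u] y).
  have cy : composable U (u.1 ++ y) (ectx [::] [:: rule_edge u] y).
    exact: (composable_ctx [::] _ ci).
  have := path_interchange U_pres simP n (lambda_composable x) cy.
  have := target_ctx [::] u.1 [:: rule_edge u] y; rewrite ti => ->.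
  rewrite lambda_target !ectx_ctx !cats0 /=; exact: (hom_sym simP).
have su : homotopic sim (phipsi x ++ u.1 ++ y)
    (ectx (phipsi x) [:: rule_edge u] y ++ ectx (phipsi x) (lam u.2) y)
    (ectx (phipsi x) (lam u.1) y ++ ectx (phipsi x) T y).
  rewrite -!ectx_cat; apply: (hom_ctx simP); exact: lambda_natural_rule.
have sy : homotopic sim (phipsi x ++ phipsi u.1 ++ y)
    (ectx (phipsi x) T y ++ ectx (phipsi x ++ phipsi u.2) (lam y) [::])
    (ectx (phipsi x ++ phipsi u.1) (lam y) [::] ++ ectx (phipsi x) T (phipsi y)).
  have m : phipsi u.1 ++ y <> [::].
    have : phipsi u.1 <> [::].
      by apply: phi_neq0; [exact: psi_neq0 | rewrite run_psi].
    by case: (phipsi u.1).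
  have := path_interchange U_pres simP m cT (lambda_composable y).
  move/(hom_ctx simP (phipsi x) [::]).
  by rewrite !ectx_cat !ectx_ctx tT lambda_target !cats0.
have tx : target (x ++ u.1 ++ y) (ectx [::] (lam x) (u.1 ++ y))
        = phipsi x ++ u.1 ++ y.
  by rewrite (target_ctx [::]) lambda_target.
have tu : target (phipsi x ++ u.1 ++ y) (ectx (phipsi x) (lam u.1) y)
        = phipsi x ++ phipsi u.1 ++ y.
  by rewrite target_ctx lambda_target.
rewrite -tx in su; have sxu := square_paste U_pres simP sx su.
rewrite -tu -tx -target_cat in sy.
have := square_paste U_pres simP sxu sy.
rewrite Phi_psi_edge_pos // !lambda_cat !ectx_cat !ectx_ctx !cats0 -!catA /=.
by rewrite {1}/e_ctx /= cats0.
Qed.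

Lemma lambda_natural_edge E : U (e_rule E) ->
  homotopic sim (e_iota E) (E :: lam (e_tau E)) (lam (e_iota E) ++ Phi (psE E)).
Proof.
case: E => x u b y Uu; change (U u) in Uu.
case: b; first exact: lambda_natural_pos.
have := square_inv U_pres simP (s := [:: Edge x u true y])
  (lambda_natural_pos x y Uu).
by rewrite -[Edge x u false y]/(e_inv (Edge x u true y)) psi_edge_inv map_phi_inv.
Qed.

Lemma lambda_natural w s : w <> [::] -> composable U w s ->
  homotopic sim w (s ++ lam (target w s)) (lam w ++ Phi (psi_edges s)).
Proof.
elim: s w => [|E s IH] w w0 /=.
  rewrite cats0 => _; apply: (hom_refl simP) => //; exact: lambda_composable.
case=> UE <- cs; have k := IH _ (e_tau_neq0 U_pres UE) cs.
have h := lambda_natural_edge UE.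
have := square_paste U_pres simP (s := [:: E]) (hom_sym simP h) (hom_sym simP k).
by rewrite -map_cat => /(hom_sym simP).
Qed.

(** By naturality a path from [w] to [w'] is homotopic to Lambda at [w], its image
    under phi after psi, and the inverse of Lambda at [w'].  For parallel paths
    the images are homotopic, and the common factor at [w'] cancels. *)
Lemma parallel_sim (X : set (dpath A)) : homotopy_base R X ->
  (forall Z, baseK pi C X Z -> sim Z (p_one (p_iota Z))) ->
  forall P Q, parallel U P Q -> sim P Q.
Proof.
move=> Xbase simK P Q PQ.
have /(phi_parallel_sim simP Xbase simK) phiPQ := psi_path_parallel PQ.
have {phiPQ} := phiPQ (Some i1) (@run_psi_neq0 (p_iota P)).
case: P Q PQ => [w s] [w' t] [[/= w0 cs] [/= _ ct] /= ew et]; subst w'.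
change (target w s = target w t) in et.
change (homotopic sim (phipsi w) (Phi (psi_edges s)) (Phi (psi_edges t)) ->
        homotopic sim w s t).
move=> PQ; apply: (hom_cancelr U_pres simP (b := lam (target w s))).
apply: (hom_trans simP (lambda_natural w0 cs)); rewrite et.
apply: (hom_trans simP _ (hom_sym simP (lambda_natural w0 ct))).
apply: (hom_catl U_pres simP) => //; first exact: lambda_composable.
by rewrite lambda_target.
Qed.

End Naturality.

Lemma KW_homotopy_base (X : set (dpath A)) : homotopy_base R X ->
  homotopy_base U (setU (baseK pi C X) (baseW pi C i1 r r' e R psiE)).
Proof.
move=> Xbase; split=> [T [[P [j [XP n ->]]]|[u Uu <-]]|P Q].
- by apply: phi_path_closed => //; exact: Xbase.1.
- exact: pathW_closed.
split=> [PQ|PQ sim simP simKW].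
  apply: (PQ _ (parallel_homotopy_relation U_pres)) => Z KWZ.
  have [pZ eZ] : closed_path U Z.
    case: KWZ => [[T [j [XT n ->]]]|[u Uu <-]].
      by apply: phi_path_closed => //; exact: Xbase.1.
    exact: pathW_closed.
  by split=> //; split=> //; exact: pZ.1.
apply: (parallel_sim simP _ Xbase _ PQ) => Z ?; apply: simKW; [by right | by left].
Qed.

End PhiPsi.

Theorem theorem4 (A : Type) (R : set (rule A)) (S : semigroupType)
    (pi : seq A -> S) (G : set S) (X : set (dpath A))
    (I : Type) (C : I -> set S) (i1 : I) (r r' : I -> seq A) (e : seq A)
    (psiE : rule (letter pi C) -> dpath A) :
  semigroup_presentation R ->
  semigroup_defined_by R pi ->
  is_subgroup G ->
  homotopy_base R X ->
  coset_indexing G C i1 ->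
  coset_representatives pi C G i1 r r' ->
  e <> [::] ->
  is_identity_of G (pi e) ->
  psi_choice pi C i1 r r' e R psiE ->
  homotopy_base (relsU pi C i1 r r' e R)
    (setU (baseK pi C X) (baseW pi C i1 r r' e R psiE)).
Proof.
move=> Rpres Sdef _ Xbase Cidx rep e0 e_id psiEP.
exact: (KW_homotopy_base Rpres Sdef Cidx rep e0 e_id psiEP Xbase).
Qed.
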